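(* For $d\ge1$, the space $\overline{\Omega(S_d)}$ is equal to $$\left\{[\lambda_0:\ldots:\lambda_d]\in\mathrm{Gr}(1,\mathbb{R}^{d+1})=\mathbb{R}\mathbb{P}^d\ \middle|\ \lambda_i\ge0,\ \sum_{i=0}^d\lambda_i=1\right\}.$$ Hence the closed space $\overline{\Omega(S_d)}$ is a $d$-simplex.
   Context: $S_d$ is the combinatorial type of the fan of $\mathbb{P}^d$: it has $d+1$ rays and its maximal cones are the $d$-element subsets of $\{1,\dots,d+1\}$. $\Omega(S_d)\subset\mathbb{R}^d$ is the set of $v$ such that, with $h:\mathbb{R}^{d+1}\to\mathbb{R}^d$ linear given by $h(e_i)=e_i$ ($i\le d$), $h(e_{d+1})=v$, the cones $\mathrm{Cone}(h(e_i),i\in I)$, $I\in S_d$, together with $\{0\}$, form a fan of strongly convex cones with combinatorial type $S_d$ (the poset of sets $I$ of indices with $\mathrm{Cone}(h(e_i), i\in I)$ in the fan). It is identified with its image in $\mathrm{Gr}(1,\mathbb{R}^{d+1})=\mathbb{R}\mathbb{P}^d$ under $h\mapsto\ker h$. The group $G=\mathrm{Aut}_{\mathbf{Poset}}(S_d)=\mathfrak{S}_{d+1}$ acts on $\mathbb{R}\mathbb{P}^d$ by permuting coordinates, and $\overline{\Omega(S_d)}$ denotes the smallest $G$-invariant closed subset of $\mathbb{R}\mathbb{P}^d$ containing $\Omega(S_d)$. The displayed set consists of the points of $\mathbb{R}\mathbb{P}^d$ admitting a representative $(\lambda_0,\dots,\lambda_d)$ with the stated properties. *)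

(* Defs.v *)
From HB Require Import structures.
From mathcomp Require Import all_boot all_order all_algebra all_fingroup.
From mathcomp Require Import all_classical all_reals all_analysis.

Set Implicit Arguments.
Unset Strict Implicit.
Unset Printing Implicit Defensive.

Import Order.TTheory GRing.Theory Num.Theory.
Import numFieldNormedType.Exports.

Local Open Scope classical_set_scope.
Local Open Scope ring_scope.

Section Fans.
Context {R : realType} {d : nat}.
Local Notation V := 'rV[R]_d.

Definition cone (I : finType) (g : I -> V) (A : {set I}) : set V :=
  [set x | exists2 a : I -> R,
     (forall i, 0 <= a i) & x = \sum_(i in A) a i *: g i].

Definition polyhedral_cone (C : set V) : Prop :=
  exists n (g : 'I_n -> V), C = cone g [set: 'I_n]%SET.

Definition strongly_convex (C : set V) : Prop :=
  forall x, C x -> C (- x) -> x = 0.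

(* With m = 0, the cone C is a face of itself. *)
Definition is_face (F C : set V) : Prop :=
  exists2 m : {scalar V},
    (forall x, C x -> 0 <= m x) & F = C `&` [set x | m x = 0].

Record is_fan (Delta : set (set V)) : Prop := IsFan {
  fan_finite : finite_set Delta;
  fan_polyhedral : forall C, Delta C -> polyhedral_cone C;
  fan_strongly_convex : forall C, Delta C -> strongly_convex C;
  fan_face : forall C F, Delta C -> is_face F C -> Delta F;
  fan_inter : forall C D, Delta C -> Delta D ->
    is_face (C `&` D) C /\ is_face (C `&` D) D
}.

(* I ranges over all subsets of the index set, not only over those used to
   build Delta. *)
Definition comb_type (n : nat) (h : 'Hom('rV[R]_n, V)) (Delta : set (set V)) :
    set {set 'I_n} :=
  [set I | Delta (cone (fun i => h (delta_mx 0 i)) I)].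

End Fans.

(* The index set {1, ..., d+1} is 'I_d.+1; ord_max stands for d+1. *)
Definition Sd (d : nat) : set {set 'I_d.+1} :=
  [set I | exists2 J : {set 'I_d.+1}, #|J| = d & I \subset J].
Arguments Sd : clear implicits.

Lemma SdP d (I : {set 'I_d.+1}) : Sd d I <-> (#|I| <= d)%N.
Proof.
split=> [[J Jd IJ]|Id].
  by rewrite -[X in (_ <= X)%N]Jd; exact: subset_leq_card.
have : (0 < #|~: I|)%N.
  by rewrite -(ltn_add2l #|I|) cardsC card_ord addn0 ltnS.
case/card_gt0P => j; rewrite inE => jI.
exists (~: [set j])%SET; last first.
  by apply/fintype.subsetP => i iI; rewrite !inE; apply: contraNneq jI => <-.
by have := cardsC [set j]; rewrite cards1 card_ord => -[].
Qed.

Lemma Sd1 d (i : 'I_d.+1) : (0 < d)%N -> Sd d [set i]%SET.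
Proof. by move=> d0; apply/SdP; rewrite cards1. Qed.

(* Aut(Sd) = 'S_d.+1: every automorphism of the poset Sd is induced by a unique
   permutation of the rays, and conversely. *)
Lemma Sd_autP d (f : {set 'I_d.+1} -> {set 'I_d.+1}) : (0 < d)%N ->
  (set_bij (Sd d) (Sd d) f /\
   forall I J, Sd d I -> Sd d J -> (f I \subset f J) = (I \subset J)) <->
  (exists! s : 'S_d.+1, forall I, Sd d I -> f I = s @: I).
Proof.
move=> d0; split; last first.
  case=> s [fE _]; split; last first.
    move=> I J SI SJ; rewrite !fE//; apply/idP/idP; last exact: imsetS.
    move=> /fintype.subsetP IJ; apply/fintype.subsetP => i iI.
    by have := IJ _ (imset_f s iI); rewrite mem_imset//; exact: perm_inj.
  split=> [I SI|I J /set_mem SI /set_mem SJ|I SI].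
  - by apply/SdP; rewrite fE// card_imset; [exact/SdP | exact: perm_inj].
  - by rewrite !fE//; apply: imset_inj; exact: perm_inj.
  - have SI' : Sd d (s^-1%g @: I)%SET.
      by apply/SdP; rewrite card_imset; [exact/SdP | exact: perm_inj].
    exists (s^-1%g @: I)%SET => //; rewrite fE// -imset_comp -[RHS]imset_id.
    by apply: eq_imset => i /=; rewrite permKV.
case=> -[fS finj fsurj] fsub.
have S0 : Sd d finset.set0 by apply/SdP; rewrite cards0.
have f0 : f finset.set0 = finset.set0.
  have [I0 SI0 fI0] := fsurj _ S0.
  have : I0 \subset finset.set0 by rewrite -fsub// fI0 finset.sub0set.
  by rewrite finset.subset0 => /eqP I00; rewrite -{1}I00.
have f1 i : exists j, f [set i]%SET == [set j]%SET.
  have /finset.set0Pn[j ji] : f [set i]%SET != finset.set0.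
    apply/eqP => fi0.
    have : [set i]%SET \subset finset.set0 by rewrite -fsub ?fi0 ?finset.sub0set//; exact: Sd1.
    by rewrite finset.subset0 -cards_eq0 cards1.
  have [J SJ fJ] := fsurj _ (Sd1 j d0).
  have : J \subset [set i]%SET by rewrite -fsub ?fJ ?finset.sub1set//; exact: Sd1.
  rewrite finset.subset1 => /orP[/eqP <-|/eqP J0]; first by exists j; rewrite fJ.
  by move: fJ; rewrite J0 f0 => /esym/eqP; rewrite -cards_eq0 cards1.
pose t i := xchoose (f1 i).
have tE i : f [set i]%SET = [set t i]%SET by exact/eqP/(xchooseP (f1 i)).
have tinj : injective t.
  move=> i j tij; apply: finset.set1_inj.
  by apply: finj; rewrite ?tE ?tij//; apply/mem_set; exact: Sd1.
exists (perm tinj); split=> [I SI|s sE]; last first.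
  apply/permP => i; rewrite permE; apply: finset.set1_inj.
  by rewrite -tE sE ?imset_set1//; exact: Sd1.
apply/setP => j; rewrite -{1}(permKV (perm tinj) j).
rewrite [in LHS]permE -finset.sub1set -tE fsub ?finset.sub1set//; last exact: Sd1.
by rewrite -[in RHS](permKV (perm tinj) j) mem_imset//; exact: perm_inj.
Qed.

Section Omega.
Context {R : realType} {d : nat}.

Definition ray (v : 'rV[R]_d) (i : 'I_d.+1) : 'rV[R]_d :=
  if unlift ord_max i is Some j then delta_mx 0 j else v.

Definition hmap (v : 'rV[R]_d) : 'Hom('rV[R]_d.+1, 'rV[R]_d) :=
  linfun (mulmxr (\matrix_i ray v i)).

Lemma hmap_lift (v : 'rV[R]_d) (j : 'I_d) :
  hmap v (delta_mx 0 (lift ord_max j)) = delta_mx 0 j.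
Proof. by rewrite lfunE /= -rowE rowK /ray liftK. Qed.

Lemma hmap_max (v : 'rV[R]_d) : hmap v (delta_mx 0 ord_max) = v.
Proof. by rewrite lfunE /= -rowE rowK /ray unlift_none. Qed.

Definition Sd_cones (v : 'rV[R]_d) : set (set 'rV[R]_d) :=
  [set cone (fun i => hmap v (delta_mx 0 i)) I | I in Sd d] `|` [set [set 0]].

Definition Omega : set 'rV[R]_d :=
  [set v | is_fan (Sd_cones v) /\ comb_type (hmap v) (Sd_cones v) = Sd d].

End Omega.
Arguments Omega : clear implicits.

Section Gr1.
Context (R : realType) (n : nat).

Definition Gr1 : Type := {L : {vspace 'rV[R]_n} | \dim L == 1%N}.

(* Nonzero vectors, with the topology induced by R^n. *)
Definition nzvec : Type := [set x : 'rV[R]_n | x != 0].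
HB.instance Definition _ := Topological.on nzvec.

Lemma dim_line (x : nzvec) : \dim <[set_val x]> == 1%N.
Proof. by have /set_mem /= x0 := valP x; rewrite dim_vline /set_val /= x0. Qed.

Definition line_of (x : nzvec) : Gr1 := Sub <[set_val x]>%VS (dim_line x).

Lemma vpick_neq0 (L : Gr1) : vpick (val L) \in [set x : 'rV[R]_n | x != 0].
Proof. by apply/mem_set; rewrite /= vpick0 -dimv_eq0 (eqP (valP L)). Qed.

Definition line_repr (L : Gr1) : nzvec := SigSub (vpick_neq0 L).

Lemma line_reprK : cancel line_repr line_of.
Proof.
move=> L; apply/val_inj/eqP; rewrite /= eqEdim -memvE memv_pick /=.
by rewrite (eqP (valP L)) (eqP (dim_line (line_repr L))).
Qed.

(* Gr(1, R^n) carries the quotient topology along x |-> <[x]>. *)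
HB.instance Definition _ := isQuotient.Build nzvec Gr1 line_reprK.
HB.instance Definition _ := Topological.copy Gr1 (quotient_topology Gr1).

Definition perm_lfun (s : 'S_n) : 'End('rV[R]_n) := linfun (col_perm s).

Lemma dim_perm_line (s : 'S_n) (L : Gr1) :
  \dim (perm_lfun s @: val L) == 1%N.
Proof.
rewrite limg_dim_eq ?(valP L)//; apply/eqP; rewrite -subv0.
apply/subvP => x; rewrite memv_cap memv0 memv_ker lfunE /= => /andP[_ /eqP e].
by rewrite -(col_perm1 x) -(mulVg s) col_permM e linear0.
Qed.

Definition perm_line (s : 'S_n) (L : Gr1) : Gr1 :=
  Sub (perm_lfun s @: val L)%VS (dim_perm_line s L).

Definition perm_invariant (A : set Gr1) : Prop :=
  forall s L, A L -> A (perm_line s L).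

End Gr1.

Definition Omega_Gr (R : realType) (d : nat) : set (Gr1 R d.+1) :=
  [set L | exists2 v, Omega R d v & val L = lker (hmap v)].

Definition closed_Omega (R : realType) (d : nat) : set (Gr1 R d.+1) :=
  smallest [set A | closed A /\ perm_invariant A] (@Omega_Gr R d).
Arguments closed_Omega : clear implicits.

Definition std_simplex (R : realType) (d : nat) : set 'rV[R]_d.+1 :=
  [set l | (forall i, 0 <= l 0 i) /\ \sum_i l 0 i = 1].
Arguments std_simplex : clear implicits.

Definition homeomorphism (T U : topologicalType) (A : set T) (B : set U)
    (f : T -> U) : Prop :=
  [/\ set_bij A B f, {within A, continuous f} &
      exists2 g : U -> T, {in A, cancel f g} & {within B, continuous g}].

(* Main.v *)
Require Import Defs.
From HB Require Import structures.
From mathcomp Require Import all_boot all_order all_algebra all_fingroup.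
From mathcomp Require Import all_classical all_reals all_analysis.

Set Implicit Arguments.
Unset Strict Implicit.
Unset Printing Implicit Defensive.

Import Order.TTheory GRing.Theory Num.Theory.
Import numFieldNormedType.Exports.

Local Open Scope classical_set_scope.
Local Open Scope ring_scope.

(** The kernel of hmap v is the line spanned by (- v, 1), so the set of
    parameters v is seen in the projective space as a set of lines of linear
    relations between the d + 1 rays.

    A fan of the required type forces this relation to have nonnegative
    coefficients (Omega_le0): a positive coordinate of v would make v lie in
    the cone spanned by the standard basis, and the set of all rays would then
    belong to the combinatorial type.  Conversely, if the relation has positive
    coefficients, then the cones on proper subsets of rays do form a fan
    (lt0_Omega).  Indeed hmap v is injective on the proper faces of the
    nonnegative orthant (hmap_orthant_inj), so that the fan is the image of
    the poset of these faces.

    Omega therefore contains the lines spanned by positive vectors and is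
    contained in the set of lines spanned by points of the simplex.  The latter
    set is stable under permutations of the coordinates, and the former is dense
    in it: a point of the simplex is the limit of the positive vectors obtained
    by adding 1 / (k + 1) to each of its coordinates.

    What remains is topological, and rests on a single function: the map
    x |-> (\sum_i x_i) / (\sum_i |x_i|)^2 x on nonzero vectors does not change
    when x is rescaled, hence descends to a continuous map line_coord from the
    projective space to R^(d+1), and it fixes the simplex.  The lines spanned by
    points of the simplex are exactly those that line_coord sends into the
    simplex, which shows that they form a closed set; and line_coord is a
    continuous inverse of l |-> <[l]> on it. *)

(** * Cones spanned by the rays, as images of faces of the orthant *)

Section RayCones.
Context {R : realType} {d : nat}.
Implicit Types (v : 'rV[R]_d) (x y : 'rV[R]_d.+1) (I J K : {set 'I_d.+1}).

Lemma hmapE v x j :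
  hmap v x 0 j = x 0 (lift ord_max j) + x 0 ord_max * v 0 j.
Proof.
rewrite lfunE /= mxE (bigD1_ord ord_max)//= addrC; congr (_ + _); last first.
  by rewrite mxE /ray unlift_none.
rewrite (bigD1 j)//= big1 => [|k kj];
  rewrite !mxE /ray liftK mxE ?eqxx ?mulr1 ?addr0//.
by rewrite eq_sym (negbTE kj) mulr0.
Qed.

(** Coefficients of the relation v - \sum_j v_j e_j = 0, which generates all
    linear relations between the rays (hmap_eq0). *)
Definition ray_relation v : 'rV[R]_d.+1 :=
  \row_i if unlift ord_max i is Some j then - v 0 j else 1.

Lemma ray_relation_max v : ray_relation v 0 ord_max = 1.
Proof. by rewrite mxE unlift_none. Qed.

Lemma ray_relation_lift v j : ray_relation v 0 (lift ord_max j) = - v 0 j.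
Proof. by rewrite mxE liftK. Qed.

Lemma hmap_eq0 v x :
  hmap v x = 0 <-> exists c, x = c *: ray_relation v.
Proof.
split=> [/rowP h0|[c ->]].
  exists (x 0 ord_max); apply/rowP => i; rewrite mxE.
  have [j ->|->] := unliftP ord_max i; last by rewrite ray_relation_max mulr1.
  rewrite ray_relation_lift mulrN; apply/eqP; rewrite -addr_eq0.
  by have := h0 j; rewrite hmapE mxE => ->.
apply/rowP => j; rewrite hmapE !mxE liftK unlift_none.
by rewrite mulr1 mulrN addNr.
Qed.

Lemma lker_hmap v : lker (hmap v) = <[ray_relation v]>%VS.
Proof.
apply/vspaceP => x; rewrite memv_ker.
by apply/eqP/vlineP => /hmap_eq0.
Qed.

(** Nonnegative coefficient vectors supported in I: working with these instead
    of the coefficient functions of a cone turns a statement on cones into one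
    on hmap v and its kernel. *)
Definition orthant_face I x : Prop :=
  (forall i, 0 <= x 0 i) /\ (forall i, i \notin I -> x 0 i = 0).

Definition ray_cone v I : set 'rV[R]_d :=
  cone (fun i => hmap v (delta_mx 0 i)) I.

Lemma hmap_sum v x : hmap v x = \sum_i x 0 i *: hmap v (delta_mx 0 i).
Proof.
rewrite {1}(row_sum_delta x) linear_sum; apply: eq_bigr => i _.
by rewrite linearZ.
Qed.

Lemma ray_coneP v I z :
  ray_cone v I z <-> exists2 x, orthant_face I x & z = hmap v x.
Proof.
split=> [[a a0 ->]|[x [x0 xI] ->]].
  exists (\row_i if i \in I then a i else 0).
    by split=> i; [rewrite mxE; case: ifP | rewrite mxE => /negbTE ->].
  rewrite hmap_sum big_mkcond; apply: eq_bigr => i _; rewrite mxE.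
  by case: ifP => // _; rewrite scale0r.
exists (fun i => x 0 i) => //; rewrite hmap_sum [RHS]big_mkcond.
by apply: eq_bigr => i _; case: ifPn => // /xI ->; rewrite scale0r.
Qed.

Lemma ray_coneW v I x : orthant_face I x -> ray_cone v I (hmap v x).
Proof. by move=> Ix; apply/ray_coneP; exists x. Qed.

Lemma orthant_faceD I x y :
  orthant_face I x -> orthant_face I y -> orthant_face I (x + y).
Proof.
move=> [x0 xI] [y0 yI]; split=> i; rewrite mxE; first exact: addr_ge0.
by move=> iI; rewrite xI// yI// addr0.
Qed.

Lemma orthant_faceZ I c x :
  0 <= c -> orthant_face I x -> orthant_face I (c *: x).
Proof.
move=> c0 [x0 xI]; split=> i; rewrite mxE; first exact: mulr_ge0.
by move=> iI; rewrite xI// mulr0.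
Qed.

Lemma orthant_face_sub I J x :
  I \subset J -> orthant_face I x -> orthant_face J x.
Proof.
move=> /fintype.subsetP IJ [x0 xI]; split=> // i iJ.
by apply: xI; apply: contra iJ; exact: IJ.
Qed.

Lemma orthant_face_delta I i : i \in I -> orthant_face I (delta_mx 0 i).
Proof.
move=> iI; split=> j; rewrite mxE ?eqxx/= ?ler0n//.
by move=> jI; case: eqP => // ji; rewrite ji iI in jI.
Qed.

(** * The parameters of fans are nonpositive *)

(** If some coordinate of v were positive, moving the negative terms of
    v = \sum_j v_j e_j to the left would write a single point both as the sum
    of v and a nonnegative combination of some of the e_j, and as a nonnegative
    combination of the e_j's.  That point lies in the face in which two cones of
    the fan meet, hence so do its summands, v among them.  But then v belongs to
    the cone spanned by the e_j's, and adding v to the e_j's yields the same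
    cone of the fan, although the set of all rays is not in Sd. *)
Lemma Omega_le0 v j : Omega R d v -> v 0 j <= 0.
Proof.
case=> vfan vtype; rewrite leNgt; apply/negP => vj0.
pose E : {set 'I_d.+1} := [set~ ord_max]%SET.
pose D : {set 'I_d.+1} := [set~ lift ord_max j]%SET.
have cardE (i : 'I_d.+1) : Sd d [set~ i]%SET.
  by apply/SdP; rewrite cardsC1 card_ord.
have inE' I : Sd d I -> Sd_cones v (ray_cone v I) by move=> SI; left; exists I.
(* The negative and the positive part of v: v + hmap v x = hmap v y. *)
pose x : 'rV[R]_d.+1 :=
  \row_i if unlift ord_max i is Some k then Num.max (- v 0 k) 0 else 0.
pose y : 'rV[R]_d.+1 :=
  \row_i if unlift ord_max i is Some k then Num.max (v 0 k) 0 else 0.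
have xD : orthant_face D x.
  split=> i; rewrite mxE; have [k ik|//] := unliftP ord_max i.
    by rewrite le_max lexx orbT.
  rewrite ik !inE negbK => /eqP/lift_inj ->.
  by apply/max_idPr; rewrite oppr_le0 ltW.
have yE : orthant_face E y.
  split=> i; rewrite mxE; have [k ik|//] := unliftP ord_max i.
    by rewrite le_max lexx orbT.
  by rewrite ik !inE negbK eq_sym (negbTE (neq_lift _ _)).
have maxD : orthant_face D (delta_mx 0 ord_max).
  by apply: orthant_face_delta; rewrite !inE neq_lift.
have xy : v + hmap v x = hmap v y.
  apply/rowP => k; rewrite mxE !hmapE !mxE !liftK !unlift_none !mul0r !addr0.
  have [vk|vk] := leP (v 0 k) 0.
    by rewrite (max_idPl _) ?oppr_ge0// subrr.
  by rewrite (max_idPr _) ?oppr_le0 ?(ltW vk)// addr0.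
have [_ [m m0 mE]] :=
  fan_inter vfan (inE' _ (cardE ord_max)) (inE' _ (cardE (lift ord_max j))).
have vD : ray_cone v D v by rewrite -{2}(hmap_max v); exact: ray_coneW.
have mp0 : m (v + hmap v x) = 0.
  suff : (ray_cone v E `&` ray_cone v D) (v + hmap v x) by rewrite mE => -[].
  split; first by rewrite xy; exact: ray_coneW.
  by rewrite -{2}(hmap_max v) -linearD; apply/ray_coneW/orthant_faceD.
(* m is nonnegative on both terms of the sum, so it vanishes on each. *)
have mv0 : m v = 0.
  apply/eqP; rewrite eq_le (m0 _ vD) andbT.
  by move: mp0; rewrite linearD => /eqP; rewrite addr_eq0 => /eqP ->;
     rewrite oppr_le0; apply/m0/ray_coneW.
have : (ray_cone v E `&` ray_cone v D) v by rewrite mE.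
case=> /ray_coneP[w wE vw] _.
(* The coefficient of v can be traded for one on the basis vectors. *)
have fullE : ray_cone v [set: 'I_d.+1]%SET = ray_cone v E.
  apply/seteqP; split=> z /ray_coneP[u uI ->]; last first.
    by apply/ray_coneW/(orthant_face_sub _ uI); exact: finset.subsetT.
  apply/ray_coneP.
  exists (u - u 0 ord_max *: delta_mx 0 ord_max + u 0 ord_max *: w).
    apply: orthant_faceD; last by apply: orthant_faceZ => //; exact: uI.1.
    split=> i; rewrite !mxE eqxx/=.
      by case: eqVneq => [->|_]; rewrite ?mulr1 ?subrr// mulr0 subr0 uI.1.
    by rewrite !inE negbK => /eqP ->; rewrite eqxx mulr1 subrr.
  by rewrite linearD linearB !linearZ /= -vw hmap_max scalerN subrK.
have : Sd d [set: 'I_d.+1]%SET.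
  by rewrite -vtype /comb_type /= -/(ray_cone v _) fullE; exact/inE'/cardE.
by move/SdP; rewrite cardsT card_ord ltnn.
Qed.

(** * Positive relations between the rays give fans *)

(** A functional that is nonnegative on the rays of I vanishes at a nonnegative
    combination of them exactly when it vanishes at each ray that occurs. *)
Lemma face_ray_cone v I F :
  is_face F (ray_cone v I) ->
  exists2 K : {set 'I_d.+1}, K \subset I & F = ray_cone v K.
Proof.
case=> m m0 ->.
pose K := [set i in I | m (hmap v (delta_mx 0 i)) == 0]%SET.
have KI : K \subset I by apply/fintype.subsetP => i; rewrite inE => /andP[].
have mE x : m (hmap v x) = \sum_i x 0 i * m (hmap v (delta_mx 0 i)).
  by rewrite hmap_sum linear_sum; apply: eq_bigr => i _; rewrite linearZ.
exists K => //; apply/seteqP; split=> [_ [/ray_coneP[x [x0 xI] ->] /= mx0]|].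
  apply: ray_coneW; split=> // i iK; have [iI|/xI//] := boolP (i \in I).
  have ge0 k : 0 <= x 0 k * m (hmap v (delta_mx 0 k)).
    have [kI|/xI ->] := boolP (k \in I); last by rewrite mul0r.
    by rewrite mulr_ge0//; apply/m0/ray_coneW/orthant_face_delta.
  rewrite mE in mx0.
  have /eqP := psumr_eq0P (fun k _ => ge0 k) mx0 (i := i) isT.
  rewrite mulf_eq0; move: iK; rewrite inE iI/= => /negbTE ->.
  by rewrite orbF => /eqP.
move=> _ /ray_coneP[x xK ->].
split; first exact/ray_coneW/(orthant_face_sub KI).
rewrite /= mE big1// => i _.
have [|/xK.2 ->] := boolP (i \in K); last by rewrite mul0r.
by rewrite inE => /andP[_ /eqP ->]; rewrite mulr0.
Qed.

(** As hmap v is surjective and its kernel is spanned by ray_relation v, the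
    functionals on its target are those on its source that vanish at this
    vector. *)
Lemma descend_functional v (mu : 'I_d.+1 -> R) :
  \sum_i mu i * ray_relation v 0 i = 0 ->
  exists m : {scalar 'rV[R]_d}, forall x, m (hmap v x) = \sum_i mu i * x 0 i.
Proof.
move=> mu0; pose f (y : 'rV[R]_d) := \sum_j mu (lift ord_max j) * y 0 j.
have f_linear : scalar f.
  move=> a y z; rewrite /f mulr_sumr -big_split/=; apply: eq_bigr => j _.
  by rewrite !mxE mulrDr mulrCA.
pose m : {scalar 'rV[R]_d} :=
  HB.pack f (GRing.isLinear.Build _ _ _ _ f f_linear).
exists m => x; rewrite /m /= /f.
move: mu0; rewrite (bigD1_ord ord_max)//= ray_relation_max mulr1.
move/eqP; rewrite addr_eq0 => /eqP muE.
rewrite (bigD1_ord ord_max)//= muE mulNr mulr_suml -sumrN -big_split/=.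
apply: eq_bigr => j _; rewrite hmapE ray_relation_lift mulrN mulNr opprK.
by rewrite mulrDr addrC -mulrA [v 0 j * _]mulrC.
Qed.

Lemma Sd_notin I : Sd d I -> exists i, i \notin I.
Proof.
move/SdP => Id; have : (0 < #|~: I|)%N.
  by rewrite -(ltn_add2l #|I|) cardsC card_ord addn0 ltnS.
by case/card_gt0P => i; rewrite inE; exists i.
Qed.

Lemma Sd_sub I J : I \subset J -> Sd d J -> Sd d I.
Proof.
move=> IJ /SdP Jd; apply/SdP; exact: leq_trans (subset_leq_card IJ) Jd.
Qed.

Section NegativeCoordinates.
Variable v : 'rV[R]_d.
Hypothesis v_lt0 : forall j, v 0 j < 0.

Lemma ray_relation_gt0 i : 0 < ray_relation v 0 i.
Proof.
by have [j ->|->] := unliftP ord_max i;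
   rewrite ?ray_relation_max ?ray_relation_lift ?oppr_gt0.
Qed.

(** The kernel is spanned by a vector with positive coordinates, and adding a
    positive multiple of it to a nonnegative vector leaves no coordinate equal
    to zero.  The case I = J is the injectivity of hmap v on a proper face; two
    different faces are needed to compute the intersection of two cones. *)
Lemma hmap_orthant_inj I J x y : Sd d I -> Sd d J ->
  orthant_face I x -> orthant_face J y -> hmap v x = hmap v y -> x = y.
Proof.
move=> /Sd_notin[i iI] /Sd_notin[j jJ] [x0 xI] [y0 yJ] /eqP.
rewrite -subr_eq0 -linearB => /eqP/hmap_eq0[c xyE].
have coord k : x 0 k = y 0 k + c * ray_relation v 0 k.
  have -> : x = c *: ray_relation v + y by rewrite -xyE subrK.
  by rewrite 2!mxE addrC.
suff c0 : c = 0 by apply/eqP; rewrite -subr_eq0 xyE c0 scale0r.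
apply/eqP; rewrite eq_le -(pmulr_lle0 _ (ray_relation_gt0 i)).
rewrite -[X in _ && X](pmulr_lge0 _ (ray_relation_gt0 j)).
have := coord i; rewrite xI// => /esym/eqP; rewrite addrC addr_eq0 => /eqP ->.
by rewrite oppr_le0 y0/=; have := coord j; rewrite (yJ _ jJ) add0r => <-.
Qed.

Lemma ray_coneI I J : Sd d I -> Sd d J ->
  ray_cone v I `&` ray_cone v J = ray_cone v (I :&: J)%SET.
Proof.
move=> SI SJ; apply/seteqP; split.
  move=> z [/ray_coneP[x xI ->] /ray_coneP[y yJ xy]].
  apply: ray_coneW; split=> [i|i]; first exact: xI.1.
  rewrite inE negb_and => /orP[/xI.2//|].
  by rewrite (hmap_orthant_inj SI SJ xI yJ xy) => /yJ.2.
move=> _ /ray_coneP[x xIJ ->].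
split; apply/ray_coneW/(orthant_face_sub _ xIJ).
  exact: subsetIl.
exact: subsetIr.
Qed.

(** The supporting functional takes the values 0 on the rays of K and 1 on the
    other rays, except at a ray outside I, where its value is dictated by the
    linear relation between the rays. *)
Lemma ray_cone_face I K : Sd d I -> K \subset I ->
  is_face (ray_cone v K) (ray_cone v I).
Proof.
move=> /Sd_notin[j jI] KI.
pose off k : R := (k \notin K)%:R.
pose mu k := if k == j
  then - (\sum_(i | i != j) off i * ray_relation v 0 i) / ray_relation v 0 j
  else off k.
have [|m mE] := @descend_functional v mu.
  rewrite (bigD1 j)//= {1}/mu eqxx divfK ?gt_eqF ?ray_relation_gt0//.
  apply/eqP; rewrite addrC subr_eq0; apply/eqP/eq_bigr => i ij.
  by rewrite /mu (negbTE ij).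
have mI x : orthant_face I x -> m (hmap v x) = \sum_i off i * x 0 i.
  case=> _ xI; rewrite mE; apply: eq_bigr => i _; rewrite /mu.
  by case: eqVneq => // ->; rewrite xI// !mulr0.
have off0 x i : orthant_face I x -> 0 <= off i * x 0 i.
  by move=> xI; rewrite mulr_ge0 ?ler0n ?xI.1.
exists m => [_ /ray_coneP[x xI ->]|].
  by rewrite mI// sumr_ge0// => i _; exact: off0.
apply/seteqP; split=> [_ /ray_coneP[x xK ->]|_ [/ray_coneP[x xI ->] /=]].
  have xI := orthant_face_sub KI xK.
  split; first exact: ray_coneW.
  rewrite /= mI// big1// => i _; rewrite /off.
  by have [_|/xK.2 ->] := boolP (i \in K); rewrite ?mul0r ?mulr0.
rewrite mI// => sum0; apply: ray_coneW; split=> [i|i iK]; first exact: xI.1.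
have /eqP := psumr_eq0P (fun i _ => off0 x i xI) sum0 (i := i) isT.
by rewrite /off iK mul1r => /eqP.
Qed.

Lemma ray_cone_strongly_convex I : Sd d I -> strongly_convex (ray_cone v I).
Proof.
move=> SI z /ray_coneP[x xI ->] /ray_coneP[y yI Nxy].
have xy0 : x + y = 0.
  apply: (@hmap_orthant_inj I I) => //; first exact: orthant_faceD.
    by split=> i; rewrite mxE.
  by rewrite linear0 linearD /= -Nxy subrr.
suff -> : x = 0 by rewrite linear0.
apply/rowP => i; have /rowP/(_ i) := xy0; rewrite !mxE => /eqP.
by rewrite paddr_eq0 ?xI.1 ?yI.1// => /andP[/eqP].
Qed.

Lemma ray_cone_polyhedral I : polyhedral_cone (ray_cone v I).
Proof.
exists d.+1, (fun i => if i \in I then hmap v (delta_mx 0 i) else 0).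
apply/seteqP; split=> z [a a0 ->]; exists a => //.
  rewrite [LHS]big_mkcond; apply: eq_big => i; rewrite ?inE// => _.
  by case: ifP => // _; rewrite scaler0.
rewrite [RHS]big_mkcond; apply: eq_big => i; rewrite ?inE// => _.
by case: ifP => // _; rewrite scaler0.
Qed.

Lemma ray_cone0 : ray_cone v finset.set0 = [set 0].
Proof.
apply/seteqP; split=> [z [a _ ->]|_ ->]; first by rewrite big_set0.
by exists (fun=> 0) => //; rewrite big_set0.
Qed.

Lemma Sd_set0 : Sd d finset.set0.
Proof. by apply/SdP; rewrite cards0. Qed.

Lemma Sd_conesP C : Sd_cones v C <-> exists2 I, Sd d I & C = ray_cone v I.
Proof.
split=> [[[I SI <-]|->]|[I SI ->]]; [by exists I| |by left; exists I].
by exists finset.set0; [exact: Sd_set0|rewrite ray_cone0].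
Qed.

(** The cone generated by all the rays is the whole space: in particular it
    contains the opposite of a ray, whereas the cones of the fan are strongly
    convex. *)
Lemma ray_coneT_notin : (0 < d)%N ->
  ~ Sd_cones v (ray_cone v [set: 'I_d.+1]%SET).
Proof.
move=> d0 /Sd_conesP[I SI TI]; have := ray_cone_strongly_convex SI.
rewrite -TI => /(_ (hmap v (delta_mx 0 (lift ord_max (Ordinal d0))))).
have onT x : (forall i, 0 <= x 0 i) -> ray_cone v [set: 'I_d.+1]%SET (hmap v x).
  by move=> x0; apply: ray_coneW; split=> // i; rewrite inE.
set i := lift _ _.
have -> : - hmap v (delta_mx 0 i) =
    hmap v ((ray_relation v 0 i)^-1 *: ray_relation v - delta_mx 0 i).
  rewrite linearB [X in X - _](_ : _ = 0) ?sub0r//.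
  by apply/hmap_eq0; exists (ray_relation v 0 i)^-1.
move=> /(_ (onT _ _) (onT _ _)) ei0.
suff : hmap v (delta_mx 0 i) = 0.
  rewrite hmap_lift => /rowP/(_ (Ordinal d0)); rewrite !mxE !eqxx => /eqP.
  by rewrite oner_eq0.
apply: ei0 => k; first by rewrite mxE ler0n.
move: (ray_relation v) ray_relation_gt0 => l l_gt0; rewrite !mxE eqxx/=.
case: eqVneq => [->|_]; first by rewrite mulVf ?subrr// gt_eqF.
by rewrite subr0 mulr_ge0// ?invr_ge0 ltW.
Qed.

Lemma lt0_Omega : (0 < d)%N -> Omega R d v.
Proof.
move=> d0; split.
  have faceE C F : Sd_cones v C -> is_face F C -> Sd_cones v F.
    move=> /Sd_conesP[I SI ->] /face_ray_cone[K KI ->].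
    by apply/Sd_conesP; exists K => //; exact: Sd_sub SI.
  split=> //.
  - rewrite /Sd_cones finite_setU; split; last exact: finite_set1.
    exact/finite_image/finite_finset.
  - by move=> _ /Sd_conesP[I _ ->]; exact: ray_cone_polyhedral.
  - by move=> _ /Sd_conesP[I SI ->]; exact: ray_cone_strongly_convex.
  - move=> _ _ /Sd_conesP[I SI ->] /Sd_conesP[J SJ ->].
    by rewrite ray_coneI//; split; apply: ray_cone_face => //;
       rewrite (subsetIl, subsetIr).
apply/seteqP; split=> I; last by move=> SI; left; exists I.
rewrite /comb_type /= -/(ray_cone v I) => DI.
have [IT|IT] := eqVneq I [set: 'I_d.+1]%SET.
  by case: (ray_coneT_notin d0); rewrite -IT.
apply/SdP; rewrite -ltnS -[X in (_ < X)%N](card_ord d.+1) -cardsT.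
by apply: proper_card; rewrite finset.properEneq IT finset.subsetT.
Qed.

End NegativeCoordinates.

End RayCones.

(** * The simplex of lines in the projective space *)

Section SimplexLines.
Context {R : realType} {d : nat}.
Local Notation V := 'rV[R]_d.+1.
Implicit Types (x y : V) (L : Gr1 R d.+1).

Lemma vlineZ c x : c != 0 -> <[c *: x]>%VS = <[x]>%VS.
Proof.
move=> c0; apply/eqP; rewrite eqEdim -memvE memvZ ?memv_line//= !dim_vline.
by rewrite scaler_eq0 negb_or c0.
Qed.

Lemma continuous_row (T : topologicalType) (f : T -> V) :
  (forall i, continuous (fun t => f t 0 i)) -> continuous f.
Proof.
move=> fi t A [P Pf PA]; apply: filterS (PA) _.
have : \forall s \near t, forall i, P 0 i (f s 0 i).
  by apply: filter_forall => i; exact/fi/Pf.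
by apply: filterS => s Ps i j; rewrite ord1.
Qed.

Lemma continuous_sum_coord (h : R -> R) : continuous h ->
  continuous (fun x => \sum_i h (x 0 i)).
Proof.
move=> hc; apply: continuous_big => [|i _ x]; first exact: add_continuous.
by apply: continuous_comp; [exact: coord_continuous|exact: hc].
Qed.

Lemma simplex_closed : closed (std_simplex R d).
Proof.
pose s x : R := \sum_i x 0 i.
have -> : std_simplex R d =
    (\bigcap_(i in [set: 'I_d.+1]) (fun x : V => x 0 i) @^-1` [set t | 0 <= t])
    `&` s @^-1` [set 1].
  apply/seteqP; split=> x [x0 x1]; split=> // i; first by move=> _; exact: x0.
  exact: (x0 i).
apply: closedI.
  apply: closed_bigI => i _; apply: preimage_closed; last exact: closed_ge.
  by move=> x _; exact: coord_continuous.
apply: preimage_closed; last exact: closed_eq.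
by move=> x _; apply: (@continuous_sum_coord id) => t; exact: cvg_id.
Qed.

Lemma simplex_neq0 x : std_simplex R d x -> x != 0.
Proof.
case=> _ x1; apply: contra_eq_neq x1 => ->.
by rewrite big1 => [|i _]; rewrite ?mxE// eq_sym oner_eq0.
Qed.

(** A continuous map from the whole space to the nonzero vectors that fixes the
    simplex: it makes l |-> <[l]> on the simplex the restriction of a map that
    is continuous everywhere.  The second term vanishes on the simplex, and the
    two terms never vanish together: the zero vector has coordinate sum 0, not
    1. *)
Definition spread x : V := \row_i (`|x 0 i| + `|1 - \sum_k x 0 k|).

Lemma spread_simplex x : std_simplex R d x -> spread x = x.
Proof.
case=> x0 x1; apply/rowP => i.
by rewrite mxE x1 subrr normr0 addr0 ger0_norm.
Qed.

Lemma spread_neq0 x : spread x \in [set y : V | y != 0].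
Proof.
apply/mem_set/eqP => /rowP sx0.
have sx i : `|x 0 i| + `|1 - \sum_k x 0 k| = 0 by have := sx0 i; rewrite !mxE.
have x0 i : x 0 i = 0.
  by apply/eqP; have /eqP := sx i; rewrite paddr_eq0// normr_eq0 => /andP[].
have /eqP := sx ord0; rewrite big1// subr0 normr1 x0 normr0 add0r.
by rewrite oner_eq0.
Qed.

Lemma spread_continuous : continuous spread.
Proof.
apply: continuous_row => i x.
rewrite (_ : (fun y => _) =
  fun y : V => `|y 0 i| + `|1 - \sum_k y 0 k|); last first.
  by apply/funext => y; rewrite mxE.
apply: (@continuousD _ _ _ (fun y : V => `|y 0 i|)).
  apply: (@continuous_comp _ _ _ (fun y : V => y 0 i) Num.norm).
    exact: coord_continuous.
  exact: norm_continuous.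
apply: (@continuous_comp _ _ _ (fun y : V => 1 - \sum_k y 0 k) Num.norm).
  apply: (@continuousB R R V (fun=> 1) (fun y : V => \sum_k y 0 k)).
    exact: cst_continuous.
  by apply: (@continuous_sum_coord id) => t; exact: cvg_id.
exact: norm_continuous.
Qed.

Definition spread_line x : Gr1 R d.+1 := line_of (SigSub (spread_neq0 x)).

Lemma spread_lineE x : val (spread_line x) = <[spread x]>%VS.
Proof. by []. Qed.

Lemma line_of_continuous : continuous (@line_of R d.+1).
Proof.
have -> : @line_of R d.+1 = \pi_(Gr1 R d.+1)%qT.
  by apply/funext => x; rewrite unlock.
exact: pi_continuous.
Qed.

Lemma spread_line_continuous : continuous spread_line.
Proof.
pose s x : nzvec R d.+1 := SigSub (spread_neq0 x).
suff s_continuous : continuous s.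
  move=> x; apply: (@continuous_comp _ _ _ s (@line_of R d.+1)).
    exact: s_continuous.
  exact: line_of_continuous.
apply: (@continuous_comp_initial (nzvec R d.+1) V V set_val).
exact: spread_continuous.
Qed.

(** The exponents make this homogeneous of degree 0, also for negative
    factors: dividing x by the sum of its coordinates would be undefined on a
    hyperplane, whereas this is continuous at every nonzero vector. *)
Definition normalize x : V :=
  ((\sum_i x 0 i) / (\sum_i `|x 0 i|) ^+ 2) *: x.

Lemma sum_norm_gt0 x : x != 0 -> 0 < \sum_i `|x 0 i|.
Proof.
move=> x0; rewrite lt_def sumr_ge0 ?andbT//; apply: contra x0.
rewrite psumr_eq0// => /allP x0; apply/eqP/rowP => i; rewrite mxE.
by apply/eqP; rewrite -normr_eq0; have := x0 i (mem_index_enum _).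
Qed.

Lemma normalize_simplex x : std_simplex R d x -> normalize x = x.
Proof.
case=> x0 x1; rewrite /normalize x1.
rewrite (eq_bigr (fun i => x 0 i)) => [|i _]; last by rewrite ger0_norm.
by rewrite x1 expr1n divr1 scale1r.
Qed.

Lemma normalizeZ c x : c != 0 -> normalize (c *: x) = normalize x.
Proof.
move=> c0; rewrite /normalize scalerA; congr (_ *: _).
have -> : \sum_i (c *: x) 0 i = c * \sum_i x 0 i.
  by rewrite mulr_sumr; apply: eq_bigr => i _; rewrite mxE.
have -> : \sum_i `|(c *: x) 0 i| = `|c| * \sum_i `|x 0 i|.
  by rewrite mulr_sumr; apply: eq_bigr => i _; rewrite mxE normrM.
rewrite exprMn real_normK ?num_real//.
rewrite [LHS]mulrC mulrA mulrA -expr2 -[LHS]mulf_div.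
by rewrite divff ?mul1r// expf_neq0.
Qed.

Lemma normalize_continuous x : x != 0 -> {for x, continuous normalize}.
Proof.
move=> x0; pose s y : R := \sum_i y 0 i; pose N y : R := (\sum_i `|y 0 i|) ^+ 2.
apply: (@continuousZ _ _ V (fun y => s y / N y) id); last exact: cvg_id.
apply: (@continuousM _ V s (fun y => (N y)^-1)).
  by apply: (@continuous_sum_coord id) => t; exact: cvg_id.
apply: (@continuousV _ V N); first by rewrite expf_neq0// gt_eqF// sum_norm_gt0.
have := @continuous_sum_coord Num.norm (@norm_continuous _ _) x.
by move=> Nx; apply: (@continuousM _ V).
Qed.

Definition line_coord L : V := normalize (vpick (val L)).

Lemma line_coordE L x :
  x != 0 -> val L = <[x]>%VS -> line_coord L = normalize x.
Proof.
move=> x0 Lx; rewrite /line_coord.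
have /vlineP[c pE] : vpick (val L) \in <[x]>%VS by rewrite -Lx memv_pick.
rewrite pE normalizeZ//; apply: contraTneq isT => c0.
have := vpick_neq0 L => /set_mem /=.
by rewrite pE c0 scale0r eqxx.
Qed.

Lemma line_coord_continuous : continuous line_coord.
Proof.
apply/quotient_continuous.
have -> : line_coord \o \pi_(Gr1 R d.+1)%qT =
    fun x : nzvec R d.+1 => normalize (set_val x).
  apply/funext => x /=; rewrite unlock; apply: line_coordE => //.
  by have /set_mem := valP x.
move=> x; apply: (@continuous_comp _ _ _ set_val normalize).
  exact: initial_continuous.
have x0 : set_val x != 0 by have /set_mem := valP x.
exact: normalize_continuous.
Qed.

Definition simplex_lines : set (Gr1 R d.+1) :=
  [set L | exists2 l, std_simplex R d l & val L = <[l]>%VS].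

(** A line whose coordinate vector lies in the simplex is spanned by this
    vector, as the latter is a nonzero multiple of a generator. *)
Lemma simplex_linesE : simplex_lines = line_coord @^-1` std_simplex R d.
Proof.
apply/seteqP; split=> L /=.
  move=> [l Sl Ll]; rewrite /= (line_coordE (simplex_neq0 Sl) Ll).
  by rewrite normalize_simplex.
move=> SL; exists (line_coord L) => //.
apply/esym/eqP; rewrite eqEdim dim_vline (simplex_neq0 SL) (eqP (valP L)) andbT.
by rewrite -memvE memvZ// memv_pick.
Qed.

Lemma simplex_lines_closed : closed simplex_lines.
Proof.
rewrite simplex_linesE; apply: preimage_closed; last exact: simplex_closed.
by move=> L _; exact: line_coord_continuous.
Qed.

Lemma simplex_lines_perm : perm_invariant simplex_lines.
Proof.
move=> s L [l [l0 l1] Ll]; exists (col_perm s l); last first.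
  by rewrite /= Ll limg_line lfunE.
split=> [i|]; first by rewrite mxE.
under eq_bigr do rewrite mxE.
by rewrite -l1 [RHS](reindex_inj (@perm_inj _ s)).
Qed.

Lemma spread_line_simplex x :
  std_simplex R d x -> val (spread_line x) = <[x]>%VS.
Proof. by move=> Sx; rewrite spread_lineE spread_simplex. Qed.

Lemma simplex_homeomorphism :
  homeomorphism (std_simplex R d) simplex_lines spread_line.
Proof.
have coordK x : std_simplex R d x -> line_coord (spread_line x) = x.
  move=> Sx; rewrite (line_coordE (simplex_neq0 Sx)) ?normalize_simplex//.
  exact: spread_line_simplex.
split; [split| |exists line_coord].
- by move=> x Sx; exists x => //; exact: spread_line_simplex.
- by move=> x y /set_mem Sx /set_mem Sy xy; rewrite -(coordK x)// xy coordK.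
- move=> L [l Sl Ll]; exists l => //; apply/val_inj.
  by rewrite Ll -spread_line_simplex.
- exact/continuous_subspaceT/spread_line_continuous.
- by move=> x /set_mem; exact: coordK.
- exact/continuous_subspaceT/line_coord_continuous.
Qed.

Lemma Omega_Gr_gt0 L x : (0 < d)%N ->
  (forall i, 0 < x 0 i) -> val L = <[x]>%VS -> Omega_Gr L.
Proof.
move=> d0 x0 Lx.
pose v : 'rV[R]_d := \row_j (- (x 0 (lift ord_max j) / x 0 ord_max)).
exists v; first by apply: lt0_Omega => // j; rewrite mxE oppr_lt0 divr_gt0.
have -> : val L = <[ray_relation v]>%VS; last by rewrite lker_hmap.
have xE : x = x 0 ord_max *: ray_relation v.
  apply/rowP => i; rewrite !mxE.
  case: unliftP => [j ->|->]; last by rewrite mulr1.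
  by rewrite mxE opprK mulrC divfK// gt_eqF.
by rewrite Lx xE vlineZ// gt_eqF.
Qed.

Lemma Omega_Gr_simplex : @Omega_Gr R d `<=` simplex_lines.
Proof.
move=> L [v Ov Lv]; rewrite /simplex_lines /= Lv lker_hmap.
have x0 i : 0 <= ray_relation v 0 i.
  have [j ->|->] := unliftP ord_max i; last by rewrite ray_relation_max.
  by rewrite ray_relation_lift oppr_ge0 Omega_le0.
have := ray_relation_max v; move: (ray_relation v) x0 => x x0 x1.
have s0 : 0 < \sum_i x 0 i.
  by rewrite (bigD1 ord_max)//= x1 ltr_pwDl// sumr_ge0.
exists ((\sum_i x 0 i)^-1 *: x).
  split=> [i|]; first by rewrite mxE mulr_ge0// invr_ge0 ltW.
  under eq_bigr do rewrite mxE.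
  by rewrite -mulr_sumr mulVf// gt_eqF.
by rewrite vlineZ// invr_eq0 gt_eqF.
Qed.

(** Every point of the simplex is a limit of positive vectors, and these span
    lines in Omega. *)
Lemma simplex_lines_sub (A : set (Gr1 R d.+1)) : (0 < d)%N ->
  closed A -> @Omega_Gr R d `<=` A -> simplex_lines `<=` A.
Proof.
move=> d0 clA OA L [l Sl Ll]; have [l0 l1] := Sl.
(* The vector u k lies outside the simplex, but spread keeps it positive. *)
pose u k : V := l + k.+1%:R^-1 *: const_mx 1.
have -> : L = spread_line l by apply/val_inj; rewrite Ll spread_line_simplex.
apply: (@closed_cvg _ _ \oo _ (spread_line \o u) A clA).
  apply: nearW => k; apply: OA; apply: (@Omega_Gr_gt0 _ (spread (u k))) => // i.
  rewrite mxE ltr_pwDl// normr_gt0 gt_eqF// !mxE mulr1.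
  by rewrite ltr_wpDl// invr_gt0.
suff ul : u x @[x --> \oo] --> l.
  by apply: (cvg_comp _ _ ul); exact: spread_line_continuous.
rewrite -[l]addr0 -(scale0r (const_mx 1)).
apply: cvgD; first exact: cvg_cst.
by apply: cvgZ; [exact: cvg_harmonic|exact: cvg_cst].
Qed.

Lemma closed_OmegaE : (0 < d)%N -> closed_Omega R d = simplex_lines.
Proof.
move=> d0; apply/seteqP; split.
  apply: smallest_sub; last exact: Omega_Gr_simplex.
  by split; [exact: simplex_lines_closed|exact: simplex_lines_perm].
by move=> L SL A [[clA _] OA]; exact: (simplex_lines_sub d0 clA OA).
Qed.

End SimplexLines.

Theorem proposition3p3p2 (R : realType) (d : nat) (hd : (0 < d)%N) :
  closed_Omega R d =
    [set L : Gr1 R d.+1 |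
      exists2 l : 'rV[R]_d.+1,
        (forall i, 0 <= l 0 i) /\ \sum_i l 0 i = 1 & val L = <[l]>%VS]
  /\ exists2 f : 'rV[R]_d.+1 -> Gr1 R d.+1,
       (forall l, std_simplex R d l -> val (f l) = <[l]>%VS) & homeomorphism (std_simplex R d) (closed_Omega R d) f.
Proof.
have closedE := @closed_OmegaE R d hd.
split; first exact: closedE.
exists spread_line; first exact: spread_line_simplex.
by rewrite closedE; exact: simplex_homeomorphism.
Qed.
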